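(* Let $L>0$, let $f\in\mathcal{F}^{1,1}_L$ have a minimizer $x^\star\in\mathbb{R}^n$, and put $f^\star=f(x^\star)$. Let $$\beta\in[0,1),\qquad \alpha\in\Bigl(0,\frac{2(1-\beta)}{L}\Bigr).$$ Let $x_0\in\mathbb{R}^n$, $x_{-1}=x_0$, and let $\{x_k\}$ be generated by the Heavy-ball iteration $$x_{k+1}=x_k-\alpha\nabla f(x_k)+\beta(x_k-x_{k-1}),\qquad k\in\mathbb{N}_0 .$$ For $T\in\mathbb{N}_0$ let $\overline{x}_T=\frac{1}{T+1}\sum_{k=0}^{T}x_k$. Then for every $T\in\mathbb{N}_0$, $$f(\overline{x}_T)-f^\star\le\begin{cases}\dfrac{\|x_0-x^\star\|^2}{2(T+1)}\Bigl(\dfrac{L\beta}{1-\beta}+\dfrac{1-\beta}{\alpha}\Bigr), & \text{if } \alpha\in\bigl(0,\tfrac{1-\beta}{L}\bigr],\\[3mm] \dfrac{\|x_0-x^\star\|^2}{2(T+1)\,(2(1-\beta)-\alpha L)}\Bigl(L\beta+\dfrac{(1-\beta)^2}{\alpha}\Bigr), & \text{if } \alpha\in\bigl[\tfrac{1-\beta}{L},\tfrac{2(1-\beta)}{L}\bigr).\end{cases}$$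
   Context: $\|\cdot\|$ is the Euclidean norm on $\mathbb{R}^n$ and $\mathbb{N}_0=\{0,1,2,\dots\}$. A function $f:\mathbb{R}^n\to\mathbb{R}$ belongs to the class $\mathcal{F}^{1,1}_L$ if it is convex, continuously differentiable, and its gradient is Lipschitz continuous with constant $L$, i.e. $0\le f(y)-f(x)-\langle\nabla f(x),y-x\rangle\le\frac{L}{2}\|x-y\|^2$ for all $x,y\in\mathbb{R}^n$. *)

(* Defs.v *)
From mathcomp Require Export all_boot all_order all_algebra.
From mathcomp Require Export all_classical all_reals all_analysis.

Set Implicit Arguments.
Unset Strict Implicit.
Unset Printing Implicit Defensive.

Export Order.TTheory GRing.Theory Num.Theory.
Export numFieldNormedType.Exports.

Local Open Scope classical_set_scope.
Local Open Scope ring_scope.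

(* The library's norm [`|u|] on row vectors is the sup norm; the topology, and
   hence [continuous], [differentiable] and ['D_v f], agree with those of the
   Euclidean norm below. *)
Definition enorm (R : realType) (n : nat) (u : 'rV[R]_n) : R :=
  Num.sqrt (\sum_(i < n) u 0 i ^+ 2).

Definition grad (R : realType) (n : nat) (f : 'rV[R]_n -> R)
    (x : 'rV[R]_n) : 'rV[R]_n :=
  \row_(i < n) 'D_(delta_mx 0 i) f x.

Record F11 (R : realType) (n : nat) (L : R) (f : 'rV[R]_n -> R) : Prop := {
  F11_convex : convex_function setT f;
  F11_differentiable : forall x, differentiable f x;
  F11_continuous_grad : continuous (grad f);
  F11_lipschitz_grad :
    forall x y, enorm (grad f x - grad f y) <= L * enorm (x - y)
}.

(* Iterates are indexed by [int] so that x_{-1} is an actual term of the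
   sequence; the values at indices below -1 are unconstrained and unused. *)
Definition heavy_ball (R : realType) (n : nat) (f : 'rV[R]_n -> R)
    (alpha beta : R) (x : int -> 'rV[R]_n) : Prop :=
  x (-1) = x 0 /\
  forall k : nat,
    x (k%:Z + 1) =
      x k%:Z - alpha *: grad f (x k%:Z) + beta *: (x k%:Z - x (k%:Z - 1)).

Definition running_average (R : realType) (n : nat) (x : int -> 'rV[R]_n)
    (T : nat) : 'rV[R]_n :=
  (T.+1%:R)^-1 *: \sum_(0 <= k < T.+1) x k%:Z.

(* Main.v *)
(* With [p k = beta / (1 - beta) *: (x k - x (k - 1))] the heavy-ball step becomes
   the gradient-like step
     [x (k + 1) + p (k + 1) = x k + p k - alpha / (1 - beta) *: grad f (x k)].
   Expanding the squared distance of [x k + p k] to the minimizer, the inner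
   products [<grad f (x k), x k - xstar>] and [<grad f (x k), x k - x (k - 1)>] are
   bounded below by function-value gaps, the former with a squared gradient to
   spare. The resulting inequality telescopes; the average is then handled by
   convexity and the remaining [f (x 0) - f xstar] by smoothness. *)
Require Import Defs.
From mathcomp Require Import ring lra.
Set Implicit Arguments.
Unset Strict Implicit.
Unset Printing Implicit Defensive.


Local Open Scope classical_set_scope.
Local Open Scope ring_scope.

(** * Euclidean inner product *)

Definition dot (R : realType) (n : nat) (u v : 'rV[R]_n) : R :=
  \sum_(i < n) u 0 i * v 0 i.

Lemma dotC (R : realType) n (u v : 'rV[R]_n) : dot u v = dot v u.
Proof. by apply: eq_bigr => i _; rewrite mulrC. Qed.

Lemma dotDl (R : realType) n (u v w : 'rV[R]_n) :
  dot (u + v) w = dot u w + dot v w.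
Proof. by rewrite -big_split; apply: eq_bigr => i _; rewrite mxE mulrDl. Qed.

Lemma dotZl (R : realType) n a (u v : 'rV[R]_n) : dot (a *: u) v = a * dot u v.
Proof. by rewrite mulr_sumr; apply: eq_bigr => i _; rewrite mxE mulrA. Qed.

Lemma dotNl (R : realType) n (u v : 'rV[R]_n) : dot (- u) v = - dot u v.
Proof. by rewrite -scaleN1r dotZl mulN1r. Qed.

Lemma dotDr (R : realType) n (u v w : 'rV[R]_n) :
  dot w (u + v) = dot w u + dot w v.
Proof. by rewrite dotC dotDl !(dotC _ w). Qed.

Lemma dotZr (R : realType) n a (u v : 'rV[R]_n) : dot v (a *: u) = a * dot v u.
Proof. by rewrite dotC dotZl dotC. Qed.

Lemma dotNr (R : realType) n (u v : 'rV[R]_n) : dot v (- u) = - dot v u.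
Proof. by rewrite dotC dotNl dotC. Qed.

Lemma dot0l (R : realType) n (v : 'rV[R]_n) : dot 0 v = 0.
Proof. by apply: big1 => i _; rewrite mxE mul0r. Qed.

Lemma dot0r (R : realType) n (v : 'rV[R]_n) : dot v 0 = 0.
Proof. by rewrite dotC dot0l. Qed.

Definition dotE := (dotDl, dotDr, dotZl, dotZr, dotNl, dotNr).

Lemma dot_ge0 (R : realType) n (u : 'rV[R]_n) : 0 <= dot u u.
Proof. by apply: sumr_ge0 => i _; rewrite -expr2 sqr_ge0. Qed.

Lemma dot_eq0 (R : realType) n (u : 'rV[R]_n) : dot u u = 0 -> u = 0.
Proof.
move=> /eqP; rewrite psumr_eq0 => [/allP u0|i _]; last by rewrite -expr2 sqr_ge0.
apply/rowP => i; rewrite mxE; apply/eqP.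
by have := u0 i (mem_index_enum i); rewrite -expr2 sqrf_eq0.
Qed.

Lemma enorm_sqr (R : realType) n (u : 'rV[R]_n) : enorm u ^+ 2 = dot u u.
Proof.
rewrite sqr_sqrtr; last by apply: sumr_ge0 => i _; rewrite sqr_ge0.
by apply: eq_bigr => i _; rewrite expr2.
Qed.

(** * Tangent and quadratic bounds for smooth convex functions *)

Lemma derive_dot_grad (R : realType) n (f : 'rV[R]_n -> R) (x v : 'rV[R]_n) :
  differentiable f x -> 'D_v f x = dot (grad f x) v.
Proof.
move=> df; rewrite deriveE// [in LHS](row_sum_delta v) linear_sum.
apply: eq_bigr => i _.
by rewrite linearZ /= mxE deriveE// mulrC.
Qed.

Lemma is_derive_line (R : realType) n (f : 'rV[R]_n -> R) (x v : 'rV[R]_n) (t : R) :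
  (forall z, differentiable f z) ->
  is_derive t 1 (fun s => f (x + s *: v)) (dot (grad f (x + t *: v)) v).
Proof.
move=> df; rewrite -derive_dot_grad//.
(* The difference quotient at [t] along the line is that of [f] at [x + t *: v] in direction [v]. *)
have E : (fun h : R => h^-1 *: (((fun s => f (x + s *: v)) \o shift t) (h *: 1)
            - f (x + t *: v))) =
         (fun h : R => h^-1 *: ((f \o shift (x + t *: v)) (h *: v)
            - f (x + t *: v))).
  apply/funext => h /=; congr (_ *: (f _ - _)).
  by rewrite scalerDl addrCA [h%:A]mulr1.
split; last by rewrite /derive E.
by rewrite /derivable E; exact: diff_derivable.
Qed.

(** On the segment, [f] minus the linear and quadratic terms of the bound has derivative [dot (grad
    f (x + t *: v) - grad f x) v - L * t * dot v v], nonpositive by the Lipschitz condition. *)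
Lemma descent (R : realType) n (L : R) (f : 'rV[R]_n -> R) (x v : 'rV[R]_n) :
  0 < L -> (forall z, differentiable f z) ->
  (forall y z, enorm (grad f y - grad f z) <= L * enorm (y - z)) ->
  f (x + v) <= f x + dot (grad f x) v + L / 2 * dot v v.
Proof.
move=> L0 df lip.
pose h := fun t : R => f (x + t *: v)
   + (- dot (grad f x) v * t + - (L / 2 * dot v v) * t ^+ 2).
have dh (t : R) : is_derive t 1 h (dot (grad f (x + t *: v)) v
    + (- dot (grad f x) v - L * dot v v * t)).
  apply: is_deriveD; first exact: is_derive_line.
  by apply: is_derive_eq; rewrite /GRing.scale/=; field.
have : h 1 <= h 0.
  apply: (@ler0_derive1_le_cc _ h 0 1) => //.
  - move=> t; rewrite in_itv/= => /andP[t0 _]; rewrite derive1E derive_val.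
    set g := grad f (x + t *: v).
    have := lip (x + t *: v) x; rewrite -/g (addrC x) addrK => lt.
    have lt2 : dot (g - grad f x) (g - grad f x) <= (L * t) ^+ 2 * dot v v.
      rewrite -enorm_sqr (le_trans (lerXn2r _ _ _ lt))//.
      + by rewrite nnegrE sqrtr_ge0.
      + by rewrite nnegrE mulr_ge0 ?sqrtr_ge0 ?ltW.
      + by rewrite exprMn enorm_sqr dotZl dotZr; lra.
    (* AM-GM: [2 <a, v> <= |a|^2 / c + c |v|^2] with [c = L t] *)
    have := dot_ge0 (g - grad f x - (L * t) *: v).
    have Lt0 : 0 < L * t by rewrite mulr_gt0.
    move: lt2; rewrite !dotE (dotC v g) (dotC v (grad f x)) (dotC (grad f x) g).
    nra.
  - by apply: continuous_subspaceT => t; apply/differentiable_continuous/derivable1_diffP.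
  - by rewrite in_itv/= lexx ler01.
  - by rewrite in_itv/= lexx ler01.
by rewrite /h scale1r scale0r addr0; lra.
Qed.

Lemma first_order_convex (R : realType) n (L : R) (f : 'rV[R]_n -> R) (x v : 'rV[R]_n) :
  0 < L -> F11 L f -> f x + dot (grad f x) v <= f (x + v).
Proof.
move=> L0 [cf df _ lip].
(* [x] lies between [x - s v] and [x + v]; convexity there and the descent lemma
   at [x - s v] give the claim up to [O(s)]. *)
have H (s : R) : 0 < s ->
    f x + dot (grad f x) v - f (x + v) <= s * (L / 2 * dot v v).
  move=> s0.
  have := descent x (- s *: v) L0 df lip; rewrite !dotE => ds.
  have s1 : 0 < 1 + s by lra.
  (* Weight [s / (1 + s)] on [x + v] and [1 / (1 + s)] on [x - s *: v] average to [x]. *)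
  have p0 : 0 <= s / (1 + s) by rewrite divr_ge0 ?ltW.
  have p1 : s / (1 + s) <= 1 by rewrite ler_pdivrMr ?mul1r; lra.
  have := cf (Itv01 p0 p1) (x + v) (x + - s *: v) (in_setT _) (in_setT _).
  have -> : conv (Itv01 p0 p1) (x + v : convex_lmodType 'rV[R]_n)
                (x + - s *: v : convex_lmodType 'rV[R]_n) = x.
    apply/rowP => i; rewrite !mxE /= /unstable.onem.
    by field; rewrite gt_eqF.
  rewrite convRE /= /unstable.onem.
  have -> : 1 - s / (1 + s) = (1 + s)^-1 by field; rewrite gt_eqF.
  rewrite mulrAC [X in _ + X]mulrC -mulrDl ler_pdivlMr//.
  move=> cx; rewrite -(ler_pM2l s0).
  have : L / 2 * (- s * (- s * dot v v)) = s * (s * (L / 2 * dot v v)) by ring.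
  by lra.
rewrite leNgt; apply/negP => lt.
set d := f x + dot (grad f x) v - f (x + v) in H.
set c := L / 2 * dot v v in H.
have d0 : 0 < d by rewrite /d; lra.
have c0 : 0 <= c by rewrite mulr_ge0 ?dot_ge0//; lra.
have c1 : 0 < c + 1 by lra.
(* This [s] turns [H] into [d <= d * c / (c + 1)], impossible for [d > 0]. *)
have := H (d / (c + 1)) (divr_gt0 d0 c1).
by rewrite mulrAC ler_pdivlMr//; nra.
Qed.

(** * Inequalities at a minimizer *)

Section minimizer.
Variables (R : realType) (n : nat) (L : R) (f : 'rV[R]_n -> R).
Variable xstar : 'rV[R]_n.
Hypotheses (L0 : 0 < L) (fF : F11 L f).
Hypothesis xstar_min : forall y, f xstar <= f y.

(** A gradient step of length [1 / L] lowers [f] by at least this amount, and cannot go below the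
    minimum. *)
Lemma gap_ge_grad x :
  dot (grad f x) (grad f x) / (2 * L) <= f x - f xstar.
Proof.
have [_ df _ lip] := fF.
have := descent x (- L^-1 *: grad f x) L0 df lip.
have := xstar_min (x + - L^-1 *: grad f x).
rewrite !dotE; set g := dot _ _ => le1 le2.
have : L / 2 * (- L^-1 * (- L^-1 * g)) = g / (2 * L) by field; rewrite gt_eqF.
have : L^-1 * g = g / (2 * L) + g / (2 * L) by field; rewrite gt_eqF.
lra.
Qed.

Lemma grad_minimizer : grad f xstar = 0.
Proof.
apply: dot_eq0; apply/eqP; rewrite eq_le dot_ge0 andbT.
by have := gap_ge_grad xstar; rewrite subrr pmulr_lle0 // invr_gt0 mulr_gt0.
Qed.

Lemma gap_le_dist x : f x - f xstar <= L / 2 * dot (x - xstar) (x - xstar).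
Proof.
have [_ df _ lip] := fF.
have := descent xstar (x - xstar) L0 df lip.
by rewrite grad_minimizer addrC subrK dot0l; lra.
Qed.

(* Compare both first-order bounds at [xstar + L^-1 *: grad f x], the minimizer
   of the quadratic upper model of [f] at [xstar] minus [dot (grad f x)]. *)
Lemma gap_add_grad_le x :
  f x - f xstar + dot (grad f x) (grad f x) / (2 * L)
  <= dot (grad f x) (x - xstar).
Proof.
have [_ df _ lip] := fF.
set g := grad f x.
have := first_order_convex x (xstar + L^-1 *: g - x) L0 fF.
have := gap_le_dist (xstar + L^-1 *: g).
rewrite -/g addrC (addrC xstar) addrK (addrC x) subrK !dotE.
set gg := dot g g => le1 le2.
have : L / 2 * (L^-1 * (L^-1 * gg)) = gg / (2 * L) by field; rewrite gt_eqF.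
have : L^-1 * gg = gg / (2 * L) + gg / (2 * L) by field; rewrite gt_eqF.
lra.
Qed.

End minimizer.

(** * Averaging and the telescoping potential *)

(** Sum the tangent inequalities at the mean [m]: the deviations [x k - m] add up to zero, so the
    linear terms cancel. *)
Lemma jensen_running_average (R : realType) n (L : R) (f : 'rV[R]_n -> R)
    (x : int -> 'rV[R]_n) T :
  0 < L -> F11 L f ->
  T.+1%:R * f (running_average x T) <= \sum_(0 <= k < T.+1) f (x k%:Z).
Proof.
move=> L0 fF; set m := running_average x T.
have mE : T.+1%:R *: m = \sum_(0 <= k < T.+1) x k%:Z.
  by rewrite scalerA divff ?scale1r// pnatr_eq0.
have -> : T.+1%:R * f m =
    \sum_(0 <= k < T.+1) (f m + dot (grad f m) (x k%:Z - m)).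
  rewrite big_split /= sumr_const_nat subn0 mulr_natl -[LHS]addr0; congr (_ + _).
  have -> : \sum_(0 <= k < T.+1) dot (grad f m) (x k%:Z - m) =
      dot (grad f m) (\sum_(0 <= k < T.+1) (x k%:Z - m)).
    elim/big_ind2 : _ => [|u u' v v' -> ->|//]; last by rewrite dotDr.
    by rewrite dot0r.
  rewrite sumrB -mE sumr_const_nat subn0 scaler_nat subrr.
  by rewrite dot0r.
apply: ler_sum => k _.
by have := first_order_convex m (x k%:Z - m) L0 fF; rewrite (addrC m) subrK.
Qed.

(* [e] is the effective step [alpha / (1 - beta)] and [w] the weight that a step
   gives to the gap [f (x k) - f xstar]; the last hypothesis lets
   [dot (grad f (x k)) (x k - xstar)] absorb the squared gradient. *)
Lemma heavy_ball_potential (R : realType) n (L : R) (f : 'rV[R]_n -> R)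
    (xstar : 'rV[R]_n) (alpha beta w : R) (x : int -> 'rV[R]_n) T
    (e := alpha / (1 - beta)) (c := beta / (1 - beta))
    (z := fun k : int => x k + c *: (x k - x (k - 1)) - xstar) :
  0 < L -> F11 L f -> (forall y, f xstar <= f y) ->
  0 <= beta < 1 -> 0 <= e -> heavy_ball f alpha beta x ->
  w <= 2 * e -> L * e ^+ 2 + w / 2 <= 2 * e ->
  w * \sum_(0 <= k < T) (f (x k%:Z) - f xstar)
    + 2 * e * c * f (x (T%:Z - 1)) + dot (z T%:Z) (z T%:Z)
  <= dot (x 0 - xstar) (x 0 - xstar) + 2 * e * c * f (x 0).
Proof.
move=> L0 fF xmin /andP[b0 b1] e0 [xm1 xS] w2 we.
have b10 : 1 - beta != 0 by rewrite gt_eqF//; lra.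
elim: T => [|T IH].
  (* Since [x (-1) = x 0], the momentum vanishes at index 0 and both sides agree. *)
  rewrite big_geq// mulr0 add0r sub0r xm1 /z sub0r xm1 subrr scaler0 addr0.
  by rewrite addrC.
apply: le_trans IH; rewrite big_nat_recr//= mulrDr.
have TE : T.+1%:Z = T%:Z + 1 by rewrite -addn1 PoszD.
rewrite TE addrK.
set g := grad f (x T).
have -> : z (T%:Z + 1) = z T%:Z - e *: g.
  rewrite /z addrK xS -/g; apply/rowP => i; rewrite !mxE /e /c.
  by field.
have H1 := gap_add_grad_le L0 fF xmin (x T).
have H2 := gap_ge_grad L0 fF xmin (x T).
have H3 := first_order_convex (x T) (x (T%:Z - 1) - x T) L0 fF.
rewrite (addrC (x T)) subrK in H3.
rewrite -/g in H1 H2 H3.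
set d := x T - x (T%:Z - 1).
have dE : x (T%:Z - 1) - x T = - d by rewrite opprB.
have zE : z T%:Z = (x T - xstar) + c *: d.
  by rewrite /z addrAC.
move: (z T%:Z) zE => zT zE.
rewrite dE dotNr in H3.
set y := x T - xstar in H1 zE.
set gg := dot g g in H1 H2.
have c0 : 0 <= c by rewrite divr_ge0//; lra.
have -> : dot (zT - e *: g) (zT - e *: g) =
    dot zT zT - 2 * e * dot g zT + e ^+ 2 * gg.
  rewrite !dotE (dotC zT g) /gg; ring.
have -> : dot g zT = dot g y + c * dot g d by rewrite zE dotDr dotZr.
have ec : 0 <= 2 * e * c by apply: mulr_ge0 => //; exact: mulr_ge0.
have ec3 : 2 * e * c * (f (x T) - f (x (T%:Z - 1))) <= 2 * e * c * dot g d.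
  by rewrite ler_wpM2l//; lra.
set D := f (x T) - f xstar in H1 H2 *.
have ggE : gg = L * (2 * (gg / (2 * L))) by field; rewrite gt_eqF.
set q := gg / (2 * L) in H1 H2 ggE.
have q0 : 0 <= q.
  by rewrite divr_ge0 ?dot_ge0// mulr_ge0// ltW.
(* With [gg = 2 * L * q] and [q <= D], trading [(2 * e - w) * D] for [(2 * e - w) * q] leaves a
   surplus of [2 * q * (2 * e - L * e ^+ 2 - w / 2)], which is nonnegative. *)
have k1 : w * D + e ^+ 2 * gg <= 2 * e * dot g y.
  apply: (@le_trans _ _ (2 * e * (D + q))); last by rewrite ler_wpM2l// mulr_ge0.
  have p1 : (2 * e - w) * q <= (2 * e - w) * D by rewrite ler_wpM2l//; lra.
  have p2 : (L * e ^+ 2 + w / 2) * q <= 2 * e * q by rewrite ler_wpM2r.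
  rewrite ggE; nra.
lra.
Qed.

Theorem theorem1 (R : realType) (n : nat) (L : R) (f : 'rV[R]_n -> R)
    (xstar : 'rV[R]_n) (alpha beta : R) (x : int -> 'rV[R]_n)
    (L_gt0 : 0 < L)
    (fF : F11 L f)
    (xstar_min : forall y : 'rV[R]_n, f xstar <= f y)
    (beta_itv : beta \in `[0, 1[)
    (alpha_itv : alpha \in `]0, (2 * (1 - beta) / L)[)
    (x_hb : heavy_ball f alpha beta x)
    (T : nat) :
  (alpha \in `]0, ((1 - beta) / L)] ->
     f (running_average x T) - f xstar <=
       enorm (x 0 - xstar) ^+ 2 / (2 * (T%:R + 1)) *
       (L * beta / (1 - beta) + (1 - beta) / alpha)) /\
  (alpha \in `[((1 - beta) / L), (2 * (1 - beta) / L)[ ->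
     f (running_average x T) - f xstar <=
       enorm (x 0 - xstar) ^+ 2 /
         (2 * (T%:R + 1) * (2 * (1 - beta) - alpha * L)) *
       (L * beta + (1 - beta) ^+ 2 / alpha)).
Proof.
have /andP[b0 b1] : 0 <= beta < 1 by move: beta_itv; rewrite in_itv.
move: alpha_itv; rewrite in_itv /= => /andP[a0 a2].
have b10 : 0 < 1 - beta by lra.
have bn0 : 1 - beta != 0 by rewrite gt_eqF.
have an0 : alpha != 0 by rewrite gt_eqF.
have T1 : 0 < T%:R + 1 :> R by rewrite ltr_wpDl ?ler0n.
set e := alpha / (1 - beta); set c := beta / (1 - beta).
have e0 : 0 < e by rewrite divr_gt0.
have c0 : 0 <= c by rewrite divr_ge0// ltW.
set G := f (running_average x T) - f xstar.
set N := enorm (x 0 - xstar) ^+ 2.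
(* The weight [w] stays free here; each step-size range then takes the largest admissible one. *)
have key w : 0 < w -> w <= 2 * e -> L * e ^+ 2 + w / 2 <= 2 * e ->
    G <= N * (1 + e * c * L) / (w * (T%:R + 1)).
  move=> w0 w2 we; rewrite ler_pdivlMr ?mulr_gt0//.
  (* With [T.+1] steps the sum runs over [0..T] and the leftover function value is [f (x T)]. *)
  have := heavy_ball_potential T.+1 L_gt0 fF xstar_min beta_itv (ltW e0) x_hb w2 we.
  have := jensen_running_average x T L_gt0 fF.
  rewrite sumrB sumr_const_nat subn0 -[f xstar *+ _]mulr_natl -natr1.
  have -> : T.+1%:Z - 1 = T by rewrite -addn1 PoszD addrK.
  set S := \sum_(_ <= _ < _) _ => J P.
  have := gap_le_dist L_gt0 fF xstar_min (x 0).
  have := dot_ge0 (x T.+1 + c *: (x T.+1 - x T) - xstar).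
  have := xstar_min (x T).
  rewrite -!enorm_sqr -/N in P *.
  move=> gap_T z_ge0 gap_0.
  have avg : w * ((T%:R + 1) * G) <= w * (S - (T%:R + 1) * f xstar).
    by rewrite ler_pM2l// mulrBr lerD2r.
  have ec : 0 <= 2 * e * c by rewrite mulr_ge0// mulr_ge0// ltW.
  have last : 2 * e * c * (f (x 0) - f (x T)) <= 2 * e * c * (L / 2 * N).
    by rewrite ler_wpM2l//; lra.
  have -> : N * (1 + e * c * L) = N + 2 * e * c * (L / 2 * N) by field.
  rewrite -/e -/c in P.
  lra.
have n0 : T%:R + 1 != 0 :> R by rewrite gt_eqF.
have Le : L * e * (1 - beta) = alpha * L by rewrite /e; field.
split.
- rewrite in_itv/= => /andP[_]; rewrite ler_pdivlMr// => a1.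
  have Le1 : L * e <= 1 by rewrite -(ler_pM2r b10) Le; lra.
  (* For [L * e <= 1] the binding constraint is [w <= 2 * e]. *)
  have := key (2 * e); rewrite mulr_gt0// => /(_ isT (lexx _)).
  have -> : N * (1 + e * c * L) / (2 * e * (T%:R + 1)) =
      N / (2 * (T%:R + 1)) * (L * beta / (1 - beta) + (1 - beta) / alpha).
    by rewrite /e /c; field; rewrite bn0 an0 n0.
  by apply; nra.
- rewrite in_itv/= => /andP[+ _]; rewrite ler_pdivrMr// => a1.
  rewrite ltr_pdivlMr// in a2.
  have Le1 : 1 <= L * e by rewrite -(ler_pM2r b10) Le; lra.
  have Le2 : L * e < 2 by rewrite -(ltr_pM2r b10) Le; lra.
  have d0 : 2 * (1 - beta) - alpha * L != 0 by rewrite gt_eqF//; lra.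
  (* This [w] makes [L * e ^+ 2 + w / 2 <= 2 * e] an equality; [1 <= L * e] gives [w <= 2 * e], and
     [L * e < 2] gives [0 < w]. *)
  have := key (2 * e * (2 - L * e)).
  have -> : N * (1 + e * c * L) / (2 * e * (2 - L * e) * (T%:R + 1)) =
      N / (2 * (T%:R + 1) * (2 * (1 - beta) - alpha * L)) *
      (L * beta + (1 - beta) ^+ 2 / alpha).
    by rewrite /e /c; field; rewrite bn0 an0 n0 d0.
  by apply; [apply: mulr_gt0; [exact: mulr_gt0 | lra] | nra | nra].
Qed.
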